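(* There exists an ideal $\mathcal{I}$ on $\mathbb{N}$ for which there is a rich abstract upper density $\delta$ with $\mathcal{Z}_\delta=\mathcal{I}$, but there is no $\mathcal{I}$-AD family of cardinality $\mathfrak{c}$.
   Context: An abstract upper density on $\mathbb{N}$ is a function $\delta:\mathcal{P}(\mathbb{N})\to[0,1]$ such that $\delta(\mathbb{N})=1$; $\delta(F)=0$ for every finite $F\subseteq\mathbb{N}$; $A\subseteq B$ implies $\delta(A)\le\delta(B)$; and $\delta(A\cup B)\le\delta(A)+\delta(B)$. It is rich if for every $r\in[0,1]$ there is $A\subseteq\mathbb{N}$ with $\delta(A)=r$. $\mathcal{Z}_\delta=\{A\subseteq\mathbb{N}:\delta(A)=0\}$. An ideal on $\mathbb{N}$ is a family $\mathcal{I}\subseteq\mathcal{P}(\mathbb{N})$ closed under finite unions and subsets, containing all finite subsets of $\mathbb{N}$, with $\mathbb{N}\notin\mathcal{I}$. $\mathcal{I}^+=\{A\subseteq\mathbb{N}:A\notin\mathcal{I}\}$. A family $\mathcal{A}\subseteq\mathcal{P}(\mathbb{N})$ is an $\mathcal{I}$-AD family if $\mathcal{A}\subseteq\mathcal{I}^+$ and $A\cap B\in\mathcal{I}$ for all distinct $A,B\in\mathcal{A}$. $\mathfrak{c}$ is the cardinality of the continuum. *)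

(* Defs.v *)
From mathcomp Require Export all_boot all_order all_algebra.
From mathcomp Require Export all_classical all_reals.

Set Implicit Arguments.
Unset Strict Implicit.
Unset Printing Implicit Defensive.

Import Order.TTheory GRing.Theory Num.Theory.
Local Open Scope classical_set_scope.
Local Open Scope ring_scope.

Record abstract_upper_density (R : realType) (delta : set nat -> R) : Prop :=
  AbstractUpperDensity {
    aud_range : forall A, 0 <= delta A <= 1;
    aud_setT : delta setT = 1;
    aud_finite : forall F, finite_set F -> delta F = 0;
    aud_mono : forall A B, A `<=` B -> delta A <= delta B;
    aud_subadd : forall A B, delta (A `|` B) <= delta A + delta B
  }.

Definition rich (R : realType) (delta : set nat -> R) : Prop :=
  forall r : R, 0 <= r <= 1 -> exists A : set nat, delta A = r.

Definition zero_sets (R : realType) (delta : set nat -> R) : set (set nat) :=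
  [set A | delta A = 0].

Record ideal_on_nat (I : set (set nat)) : Prop := IdealOnNat {
  ideal_setU : forall A B, I A -> I B -> I (A `|` B);
  ideal_subset : forall A B, A `<=` B -> I B -> I A;
  ideal_finite : forall F, finite_set F -> I F;
  ideal_proper : ~ I setT
}.

Definition positive_sets (I : set (set nat)) : set (set nat) :=
  [set A | ~ I A].

Definition AD_family (I F : set (set nat)) : Prop :=
  F `<=` positive_sets I /\
  forall A B, F A -> F B -> A <> B -> I (A `&` B).

Definition has_card_continuum (R : realType) (T : Type) (F : set T) : Prop :=
  (F #= [set: R])%card.

(* Main.v *)
Require Import Defs.
From mathcomp Require Import all_boot all_order all_algebra.
From mathcomp Require Import all_classical all_reals.
From mathcomp Require Import all_analysis.

Set Implicit Arguments.
Unset Strict Implicit.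
Unset Printing Implicit Defensive.

Import Order.TTheory GRing.Theory Num.Theory.
Import numFieldNormedType.Exports.
Local Open Scope classical_set_scope.
Local Open Scope ring_scope.

(** The ideal consists of the null sets of the finitely additive measure
    delta A = lim_U #(A `&` [0, n]) / (n + 1), where U is a free ultrafilter.
    Sets with floor (r n) elements below n have density r, so delta is rich.
    By finite additivity fewer than k + 1 sets of measure larger than 1/(k + 1)
    can have pairwise null intersections, so an AD family is a countable union
    of finite sets. *)

Lemma uncountable_real (R : realType) : ~ countable [set: R].
Proof.
move=> /countable_lebesgue_measure0.
by rewrite -set_itvNyy lebesgue_measure_itv/=.
Qed.

(** Compactness of [a, b] gives a cluster point of the image of [U]. Along an ultrafilter a cluster
    point is a limit: were the preimage of a neighbourhood not in [U], its complement would be, and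
    that complement would have to meet it. *)
Lemma ultrafilter_cvg_segment (R : realType) (T : Type) (U : set_system T)
    (u : T -> R) (a b : R) :
  UltraFilter U -> (forall t, a <= u t <= b) -> cvg (u @ U).
Proof.
move=> UU uab.
have Uab : U (u @^-1` `[a, b]).
  by apply: filterE => t /=; rewrite in_itv/= uab.
have [l [_ lu]] := @segment_compact R a b (u @ U) _ Uab.
apply/cvg_ex => /=; exists l => V /= lV.
have [//|UnV] := in_ultra_setVsetC (u @^-1` V) UU.
by have [x [/= nVx /nVx]] := lu (~` V) V UnV lV.
Qed.

Section UpperDensity.
Variables (R : realType) (delta : set nat -> R).
Hypothesis deltaP : abstract_upper_density delta.

Lemma aud_ge0 A : 0 <= delta A.
Proof. by have /andP[] := aud_range deltaP A. Qed.

Lemma zero_sets_ideal : ideal_on_nat (zero_sets delta).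
Proof.
split => /=.
- move=> A B; rewrite /zero_sets/= => A0 B0; apply/eqP.
  rewrite eq_le aud_ge0 andbT.
  by rewrite (le_trans (aud_subadd deltaP A B))// A0 B0 addr0.
- move=> A B AB; rewrite /zero_sets/= => B0; apply/eqP.
  by rewrite eq_le aud_ge0 andbT -B0 (aud_mono deltaP).
- exact: (aud_finite deltaP).
- by rewrite /zero_sets/= (aud_setT deltaP); apply/eqP; rewrite oner_eq0.
Qed.

Hypothesis delta_modular :
  forall A B, delta (A `|` B) + delta (A `&` B) = delta A + delta B.

(** Disjointness up to null sets suffices, since modularity loses only the measure of the
    intersection. *)
Lemma modular_bigsetU (f : nat -> set nat) n :
  (forall i j, i != j -> delta (f i `&` f j) = 0) ->
  delta (\big[setU/set0]_(i < n) f i) = \sum_(i < n) delta (f i).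
Proof.
move=> f0; elim: n => [|n IHn].
  by rewrite !big_ord0 (aud_finite deltaP).
(* The union of the earlier sets meets [f n] in a finite union of null sets. *)
have Un0 m : (m <= n)%N -> delta (\big[setU/set0]_(i < m) f i `&` f n) = 0.
  elim: m => [_|m IHm mn].
    by rewrite big_ord0 set0I (aud_finite deltaP).
  rewrite big_ord_recr/= setIUl; apply: (ideal_setU zero_sets_ideal).
    by apply: IHm; exact: ltnW.
  by apply: f0; rewrite ltn_eqF.
by rewrite !big_ord_recr/= -IHn -delta_modular Un0// addr0.
Qed.

Lemma modular_AD_family_countable (F : set (set nat)) :
  AD_family (zero_sets delta) F -> countable F.
Proof.
move=> [Fpos FAD].
pose Fk k := [set A | F A /\ k.+1%:R^-1 < delta A].
have -> : F = \bigcup_k Fk k.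
  apply/seteqP; split => [A FA|A [k _ []]//].
  have d0 : 0 < delta A.
    by rewrite lt_neqAle aud_ge0 andbT eq_sym; apply/eqP; exact: Fpos.
  (* Truncation plus one strictly exceeds 1 / [delta A]; inverting gives the required bound. *)
  exists (Num.truncn (delta A)^-1) => //; split => //.
  by rewrite -[ltRHS]invrK ltf_pV2 ?posrE ?invr_gt0// truncnS_gt.
apply: bigcup_countable => // k _; apply: finite_set_countable.
(* If [Fk k] were infinite, it would contain an injective sequence [f]; the union of its first k + 1
   terms would have measure larger than (k + 1) / (k + 1) = 1. *)
apply: contrapT => /infiniteP/pcard_leP[f].
have fF i : Fk k (f i) by exact: funS.
have f0 i j : i != j -> delta (f i `&` f j) = 0.
  move=> ij; apply: FAD; [by have [] := fF i|by have [] := fF j|].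
  by move=> /(@inj _ _ _ f); rewrite !inE => /(_ I I) /eqP; apply/negP.
have := aud_range deltaP (\big[setU/set0]_(i < k.+1) f i).
rewrite modular_bigsetU// => /andP[_]; apply/negP; rewrite -ltNge.
rewrite (_ : 1 = \sum_(i < k.+1) (k.+1%:R^-1 : R)); last first.
  by rewrite sumr_const card_ord -[RHS]mulr_natr mulVf// pnatr_eq0.
apply: ltr_sum => [|i _]; last by have [] := fF i.
(* The sum inequality is strict only because the index set is nonempty. *)
by apply/hasP; exists ord0; rewrite ?mem_index_enum.
Qed.

End UpperDensity.

Section UltrafilterDensity.
Variable R : realType.
Implicit Types A B : set nat.

Definition prefix_density A (n : nat) : R :=
  (\sum_(i < n.+1) ((i : nat) \in A)%:R) / n.+1%:R.

Lemma prefix_density_range A n : 0 <= prefix_density A n <= 1.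
Proof.
rewrite divr_ge0 ?sumr_ge0//= ler_pdivrMr// mul1r.
rewrite -[leRHS]mulr1 -[in leRHS](card_ord n.+1) mulr_natl -sumr_const.
by apply: ler_sum => i _; rewrite lern1 leq_b1.
Qed.

Lemma prefix_density_setT n : prefix_density setT n = 1.
Proof.
rewrite /prefix_density (eq_bigr (fun=> 1)) => [|i _]; last by rewrite in_setT.
by rewrite sumr_const card_ord divff// pnatr_eq0.
Qed.

Lemma prefix_density_mono A B n :
  A `<=` B -> prefix_density A n <= prefix_density B n.
Proof.
move=> AB; rewrite ler_pM2r ?invr_gt0//; apply: ler_sum => i _.
by rewrite ler_nat; case: (boolP (_ \in A)) => // /set_mem/AB/mem_set ->.
Qed.

Lemma prefix_density_modular A B n :
  prefix_density (A `|` B) n + prefix_density (A `&` B) n =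
  prefix_density A n + prefix_density B n.
Proof.
rewrite -!mulrDl -!big_split/=; congr (_ / _); apply: eq_bigr => i _.
by rewrite in_setU in_setI; do 2 case: (_ \in _); rewrite /= ?addr0 ?add0r.
Qed.

Lemma prefix_density_bounded_set A N n :
  A `<=` `I_N -> prefix_density A n <= N%:R * n.+1%:R^-1.
Proof.
move=> AN; rewrite ler_pM2r ?invr_gt0// -natr_sum ler_nat.
(* The minimum makes the induction go through: below [N] each step adds at most one element, and
   from [N] on none. *)
suff: (\sum_(i < n.+1) ((i : nat) \in A) <= minn n.+1 N)%N.
  by move=> /leq_trans; apply; exact: geq_minr.
elim: n.+1 => [|m IHm]; first by rewrite big_ord0.
rewrite big_ord_recr/=; case: (boolP (m \in A)) => [/set_mem/AN/= mN|_].
  by move: IHm; rewrite (minn_idPl (ltnW mN)) (minn_idPl mN) addn1.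
by rewrite addn0 (leq_trans IHm)// leq_min geq_minr geq_min leqnSn.
Qed.

(** For irrational [r] in (0, 1) these are the numbers floor(m / r) with m >= 1, a Beatty
    sequence. *)
Definition beatty_set (r : R) : set nat :=
  [set k | (Num.truncn (r * k%:R) < Num.truncn (r * k.+1%:R))%N].

(** As [r] is at most 1, the floor of r k grows by 0 or 1 at each step, so the indicator of the set
    is its increment and the count telescopes. *)
Lemma prefix_density_beatty_set r n : 0 <= r <= 1 ->
  prefix_density (beatty_set r) n = (Num.truncn (r * n.+1%:R))%:R / n.+1%:R.
Proof.
move=> /andP[r0 r1]; congr (_ / _).
elim: n.+1 => [|m IHm]; first by rewrite big_ord0 mulr0 truncn0.
rewrite big_ord_recr/= IHm -natrD; congr (_%:R).
set a := Num.truncn (r * m%:R); set b := Num.truncn (r * m.+1%:R).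
have ab : (a <= b)%N by apply: le_truncn; rewrite ler_wpM2l// ler_nat.
have ba : (b <= a.+1)%N.
  rewrite truncn_le_nat -natr1 mulrDr mulr1 -[ltRHS]natr1.
  by rewrite ltr_leD// truncnS_gt.
have -> : (m \in beatty_set r) = (a < b)%N by apply/idP/idP; rewrite inE.
by case: ltnP => ab'; apply/eqP; rewrite ?addn1 ?addn0 eqn_leq ?ab ?ab' ?ba.
Qed.

Variable U : set_system nat.
Hypotheses (UU : UltraFilter U) (ooU : \oo `<=` U).

Definition ultrafilter_density A : R := lim (prefix_density A @ U).

Lemma prefix_density_cvg A : prefix_density A @ U --> ultrafilter_density A.
Proof. exact: (ultrafilter_cvg_segment UU (prefix_density_range A)). Qed.

Lemma ultrafilter_density_unique A l :
  prefix_density A @ \oo --> l -> ultrafilter_density A = l.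
Proof.
by move=> Al; apply: cvg_lim => // V /Al/ooU.
Qed.

(** The reason for using an ultrafilter: limits along [U] exist for every set and add up, whereas a
    limsup is only subadditive. *)
Lemma ultrafilter_density_modular A B :
  ultrafilter_density (A `|` B) + ultrafilter_density (A `&` B) =
  ultrafilter_density A + ultrafilter_density B.
Proof.
apply: (@cvg_unique _ _ ((prefix_density A \+ prefix_density B) @ U)) => //.
  rewrite (_ : _ \+ _ = prefix_density (A `|` B) \+ prefix_density (A `&` B)).
    by apply: cvgD; exact: prefix_density_cvg.
  by apply/funext => n /=; rewrite prefix_density_modular.
by apply: cvgD; exact: prefix_density_cvg.
Qed.

Lemma ultrafilter_density_aud : abstract_upper_density ultrafilter_density.
Proof.
have range A : 0 <= ultrafilter_density A <= 1.
  apply/andP; split.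
    apply: (cvgr_to_ge (@prefix_density_cvg A)); apply: filterE => n.
    by have /andP[] := prefix_density_range A n.
  apply: (cvgr_to_le (@prefix_density_cvg A)); apply: filterE => n.
  by have /andP[] := prefix_density_range A n.
split=> //.
- apply: ultrafilter_density_unique; rewrite (_ : prefix_density _ = cst 1).
    exact: cvg_cst.
  by apply/funext => n; rewrite prefix_density_setT.
- move=> F /finite_seqP[s Fs]; apply: ultrafilter_density_unique.
  have FN : F `<=` `I_(\max_(i <- s) i).+1.
    by move=> i; rewrite Fs/= ltnS => si; exact: leq_bigmax_seq.
  (* A set contained in [0, N) has prefix density at most N / (n + 1), which tends to 0. *)
  apply: (squeeze_cvgr _ (cvg_cst 0)); last first.
    rewrite -[X in _ --> X](mulr0 (\max_(i <- s) i).+1%:R).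
    by apply: cvgMr; exact: cvg_harmonic.
  apply: filterE => n; rewrite prefix_density_bounded_set// andbT.
  by have /andP[] := prefix_density_range F n.
- move=> A B AB.
  apply: ler_cvg_to (@prefix_density_cvg A) (@prefix_density_cvg B) _.
  by apply: filterE => n; exact: prefix_density_mono.
- move=> A B; rewrite -ultrafilter_density_modular lerDl.
  by have /andP[] := range (A `&` B).
Qed.

Lemma ultrafilter_density_rich : rich ultrafilter_density.
Proof.
move=> r r01; exists (beatty_set r); apply: ultrafilter_density_unique.
have -> : prefix_density (beatty_set r) =
    fun n => (Num.truncn (r * n.+1%:R))%:R / n.+1%:R.
  by apply/funext => n; rewrite prefix_density_beatty_set.
have /andP[r0 _] := r01.
(* The floor of r (n + 1) is within 1 of r (n + 1), so the quotient lies between r - 1 / (n + 1) and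
   r. *)
apply: (@squeeze_cvgr _ _ _ _ (fun n => r - n.+1%:R^-1) (cst r)).
- apply: filterE => n; rewrite ler_pdivrMr// ler_pdivlMr// mulrBl mulVf//.
  by rewrite truncn_le mulr_ge0// andbT lerBlDr natr1 ltW// truncnS_gt.
- rewrite -[X in _ --> X]subr0.
  by apply: cvgB; [exact: cvg_cst|exact: cvg_harmonic].
- exact: cvg_cst.
Qed.

End UltrafilterDensity.

Theorem theorem2p5 (R : realType) :
  exists I : set (set nat),
    [/\ ideal_on_nat I,
        (exists delta : set nat -> R,
          [/\ abstract_upper_density delta, rich delta & zero_sets delta = I])
      & ~ (exists F : set (set nat), AD_family I F /\ has_card_continuum R F)].
Proof.
(* Refining [\oo] makes [U] free and makes every ordinary limit a limit along [U]. *)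
have [U [UU ooU]] := ultraFilterLemma (F := \oo) _.
have deltaP := ultrafilter_density_aud R UU ooU.
exists (zero_sets (ultrafilter_density R U)); split.
- exact: zero_sets_ideal.
- exists (ultrafilter_density R U); split => //.
  exact: ultrafilter_density_rich.
- move=> [F [FAD FR]]; apply: (@uncountable_real R).
  rewrite -(eq_countable FR); apply: (modular_AD_family_countable deltaP) => //.
  by move=> A B; exact: ultrafilter_density_modular.
Qed.
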